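(* Let $\mathcal T$ be an undirected tree and $\chi$ a monitor placement for $\mathcal T$ under which $\mathcal T$ is monitor-balanced. Then $\mu(\mathcal T\mid\chi)=1$ (under either the $\mathrm{CSP}$ or the $\mathrm{CAP}^-$ routing mechanism).
   Context: A monitor placement $\chi=(\mathfrak m,\mathfrak M)$ specifies a set $\mathfrak m$ of input nodes and a set $\mathfrak M$ of output nodes. For a node $u$ of $\mathcal T$ and a neighbour $w$ of $u$, let $T^{(wu)}(w)$ be the subtree containing $w$ obtained by deleting the edge $\{u,w\}$; the $u$-subtrees are the trees $T^{(wu)}(w)$ for $w$ ranging over the neighbours of $u$. A subtree is an input tree if it contains a node of $\mathfrak m$ and an output tree if it contains a node of $\mathfrak M$. $\mathcal T$ is monitor-balanced under $\chi$ if for every non-leaf node $u$, the family of $u$-subtrees contains at least two input trees and at least two output trees. Measurement paths: under $\mathrm{CSP}$, all simple paths from a node of $\mathfrak m$ to a different node of $\mathfrak M$; under $\mathrm{CAP}^-$, all walks from a node of $\mathfrak m$ to a node of $\mathfrak M$ except single-node paths consisting of one node in $\mathfrak m\cap\mathfrak M$. $\mathbb P(v)$ is the set of measurement paths through $v$, $\mathbb P(U)=\bigcup_{u\in U}\mathbb P(u)$. $V$ is $k$-identifiable if for all $U,W\subseteq V$ with $U\neq W$, $|U|,|W|\le k$, $\mathbb P(U)\neq\mathbb P(W)$; $\mu(\mathcal T\mid\chi)$ is the largest such $k\ge0$.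
   Formalization: Literally false, so assumed: the tree has at least 3 nodes and, under CSP only, every leaf is a monitor and of any two adjacent nodes of degree at most 2 at least one is a non-leaf monitor; each added condition is necessary for μ=1. *)

(* Defs.v *)
From mathcomp Require Import all_boot.
Set Implicit Arguments.
Unset Strict Implicit.
Unset Printing Implicit Defensive.

(* MathComp world.  A simple graph on a finite vertex type T is a symmetric
   irreflexive relation e : rel T. *)

Definition neighbours (T : finType) (e : rel T) (u : T) : {set T} :=
  [set w | e u w].

(* An isolated vertex is not a leaf. *)
Definition leaf (T : finType) (e : rel T) (u : T) : bool :=
  #|neighbours e u| == 1.

(* The size bound on cycles is needed because an edge traversed back and forth
   is a [ucycle] of size 2. *)
Definition is_tree (T : finType) (e : rel T) : Prop :=
  [/\ symmetric e, irreflexive e, 0 < #|T|,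
      (forall x y : T, connect e x y)
    & (forall c : seq T, 2 < size c -> ~ ucycle e c)].

(* The two sets may overlap. *)
Record placement (T : finType) := Placement {
  inputs : {set T};
  outputs : {set T}
}.

Definition delete_edge (T : finType) (e : rel T) (u w : T) : rel T :=
  [rel x y | e x y && ([set x; y] != [set u; w])].

(* The component of w once the edge {u, w} is deleted. *)
Definition subtree (T : finType) (e : rel T) (u w : T) : {set T} :=
  [set x | connect (delete_edge e u w) w x].

Definition subtrees (T : finType) (e : rel T) (u : T) : {set {set T}} :=
  [set subtree e u w | w in neighbours e u].

Definition input_tree (T : finType) (chi : placement T) (S : {set T}) : bool :=
  [exists x in S, x \in inputs chi].

Definition output_tree (T : finType) (chi : placement T) (S : {set T}) : bool :=
  [exists x in S, x \in outputs chi].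

(* The input trees and the output trees need not be different subtrees. *)
Definition monitor_balanced (T : finType) (e : rel T) (chi : placement T) :
    Prop :=
  forall u : T, ~~ leaf e u ->
    2 <= #|[set S in subtrees e u | input_tree chi S]| /\
    2 <= #|[set S in subtrees e u | output_tree chi S]|.

Inductive routing := CSP | CAPminus.

(* A walk is the sequence of the nodes it visits.  Under CAPminus the only walks
   from an input to an output that are discarded are those with a single node,
   which is then both an input and an output. *)
Definition measurement_path (T : finType) (e : rel T) (chi : placement T)
    (r : routing) (p : seq T) : bool :=
  if p is x :: q then
    [&& path e x q, x \in inputs chi, last x q \in outputs chi
      & match r with
        | CSP => uniq (x :: q) && (x != last x q)
        | CAPminus => q != [::]
        end]
  else false.

Definition paths_through (T : finType) (e : rel T) (chi : placement T)
    (r : routing) (v : T) : pred (seq T) :=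
  [pred p | measurement_path e chi r p & v \in p].

Definition paths_through_set (T : finType) (e : rel T) (chi : placement T)
    (r : routing) (U : {set T}) : pred (seq T) :=
  [pred p | [exists u in U, p \in paths_through e chi r u]].

Definition identifiable (T : finType) (e : rel T) (chi : placement T)
    (r : routing) (k : nat) : Prop :=
  forall U W : {set T}, U != W -> #|U| <= k -> #|W| <= k ->
    ~ (paths_through_set e chi r U =i paths_through_set e chi r W).

(* mu = k, as a relation: there is no largest k when all sets of nodes are
   told apart. *)
Definition maximal_identifiability (T : finType) (e : rel T)
    (chi : placement T) (r : routing) (k : nat) : Prop :=
  identifiable e chi r k /\
  (forall j : nat, identifiable e chi r j -> j <= k).

Definition monitors (T : finType) (chi : placement T) : {set T} :=
  inputs chi :|: outputs chi.

(* Simple paths cannot probe a leaf that is not a monitor.  Nor can they tell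
   apart two adjacent nodes x and y of degree at most 2 unless one of them is a
   non-leaf monitor: otherwise a simple path between two different monitors
   that meets one of x and y goes through both.  In a monitor-balanced tree
   each clause is thus necessary for 1-identifiability under CSP. *)
Definition CSP_nondegenerate (T : finType) (e : rel T) (chi : placement T) :
    Prop :=
  (forall x : T, leaf e x -> x \in monitors chi) /\
  (forall x y : T, e x y ->
     #|neighbours e x| <= 2 -> #|neighbours e y| <= 2 ->
     (~~ leaf e x && (x \in monitors chi)) ||
     (~~ leaf e y && (y \in monitors chi))).

(* Main.v *)
Require Import Defs.
From mathcomp Require Import all_boot.

(** Call a set of non-leaf nodes a probing set if every edge has an endpoint in
    it and if, for every node a of the set, every neighbour u of a and every
    node v <> a outside the branch at a through u, some measurement path goes
    through a and u and avoids v.  A probing set gives 1-identifiability: to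
    separate u from v, use u or v if one of them is in the set; otherwise they
    are not adjacent, and the neighbour of u in the direction of v is in the
    set.  Under CAP-, all non-leaf nodes form a probing set.  Under CSP, the
    non-leaf nodes that are monitors or have degree at least 3 form one, because
    every branch contains a leaf and hence a monitor.  Finally, a measurement
    path through a leaf also visits its neighbour w, so {leaf, w} and {w} are
    not told apart. *)

Set Implicit Arguments.
Unset Strict Implicit.
Unset Printing Implicit Defensive.

Section Tree.

Variables (T : finType) (e : rel T).
Hypothesis e_tree : is_tree e.

Implicit Types (a u v w x y : T) (s : seq T).

Let e_sym : symmetric e. Proof. by case: e_tree. Qed.
Let e_irr : irreflexive e. Proof. by case: e_tree. Qed.

(** * Branches of a tree at a node *)

Lemma adj_neq a u : e a u -> a != u.
Proof. by apply: contraTneq => ->; rewrite e_irr. Qed.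

(** A nonempty path would close up through [a] into a cycle of at least three nodes, so the path is
    empty. *)
Lemma no_detour a u w p :
  e a u -> e a w -> path e u p -> last u p = w -> uniq (u :: p) ->
  a \notin u :: p -> u = w.
Proof.
move=> eau eaw ep lp Up ap.
have [_ _ _ _ acyc] := e_tree.
case: p ep lp Up ap => [//|y p] ep lp Up ap.
case: (acyc [:: a, u, y & p]) => //.
apply/andP; split; last by rewrite cons_uniq ap.
rewrite -[cycle _ _]/(e a u && path e u (rcons (y :: p) a)).
by rewrite rcons_path eau ep lp e_sym.
Qed.

Lemma delete_edge_sym a u : symmetric (delete_edge e a u).
Proof. by move=> x y; rewrite /delete_edge /= e_sym setUC. Qed.

Lemma path_subtree a u p :
  path e u p -> a \notin u :: p -> last u p \in subtree e a u.
Proof.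
move=> ep ap; rewrite inE; apply/connectP; exists p => //.
elim: p u ap ep {1}u => [//|y p IH] u /=.
rewrite inE negb_or => /andP[au ap] /andP[euy ep] z.
rewrite (IH _ ap ep) andbT /delete_edge /= euy /=.
move: ap; rewrite inE negb_or => /andP[ay _].
by apply/eqP => /setP/(_ a); rewrite !inE eqxx (negPf au) (negPf ay).
Qed.

(** Deleting the edge has the same effect as deleting the node [a]: a simple path from [u] to [a]
    enters [a] from some neighbour, which is [u] by [no_detour], and so it uses the deleted edge. *)
Lemma subtreeP a u x : e a u -> x \in subtree e a u ->
  exists p, [/\ path e u p, last u p = x, uniq (u :: p) & a \notin u :: p].
Proof.
move=> eau; rewrite inE => /connectP[p0 dp0 ->].
case/shortenP: dp0 => p dp Up _; exists p.
have ep : path e u p by apply: sub_path dp => y z /andP[].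
split=> //; rewrite inE negb_or adj_neq //=; apply/negP => ap.
case/splitPr: ap dp ep Up => p1 p2; rewrite cat_path => /andP[_ /andP[da _]].
rewrite cat_path => /andP[ep1 /andP[ea _]].
rewrite -cat_cons cat_uniq => /and3P[U1 /hasPn/(_ a) N1 _].
have {}N1 : a \notin u :: p1 by apply: N1; rewrite mem_head.
have eu := no_detour eau _ ep1 (erefl _) U1 N1.
move: da; rewrite -eu ?[e a _]e_sym // => /andP[_].
by rewrite setUC eqxx.
Qed.

Lemma root_subtree a u : u \in subtree e a u.
Proof. by rewrite inE connect0. Qed.

Lemma subtree_root a u : e a u -> a \notin subtree e a u.
Proof.
move=> eau; apply/negP => /(subtreeP eau)[p [_ <- _]].
by rewrite mem_last.
Qed.

Lemma subtree_path a u x : e a u -> x \in subtree e a u ->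
  exists p, [/\ path e u p, last u p = x, uniq (u :: p)
              & {subset u :: p <= subtree e a u}].
Proof.
move=> eau /(subtreeP eau)[p [ep lp Up ap]]; exists p; split=> // y.
rewrite inE => /predU1P[->|yp]; first exact: root_subtree.
case/path.splitP: yp ep ap {lp Up} => p1 p2; rewrite cat_path => /andP[ep1 _].
rewrite -cat_cons mem_cat negb_or => /andP[ap1 _].
by have := path_subtree ep1 ap1; rewrite last_rcons.
Qed.

(** Joining the two paths to [x] links [u] to [w] without meeting [a]; once shortened to a simple
    path, this is a detour. *)
Lemma subtree_inj a u w x : e a u -> e a w ->
  x \in subtree e a u -> x \in subtree e a w -> u = w.
Proof.
move=> eau eaw /(subtreeP eau)[p [ep lp _ ap]] /(subtreeP eaw)[q [eq lq _ aq]].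
have av z s : path e z s -> a \notin z :: s ->
    connect [rel x y | [&& e x y, x != a & y != a]] z (last z s).
  move=> es az; apply/connectP; exists s => //.
  elim: s z es az => //= y s IH z /andP[-> es].
  rewrite inE negb_or => /andP[az as']; rewrite IH // eq_sym az /=.
  by move: as'; rewrite inE negb_or eq_sym => /andP[-> _].
have sym_av : connect_sym [rel x y | [&& e x y, x != a & y != a]].
  by apply: sym_connect_sym => y z /=; rewrite e_sym [(y != a) && _]andbC.
have := av _ _ eq aq; rewrite sym_av lq -lp => /(connect_trans (av _ _ ep ap)).
case/connectP => s0 ds0 lw; case/shortenP: ds0 lw => s ds Us _ /esym lw.
apply: (no_detour eau eaw _ lw Us).
  by apply: sub_path ds => y z /and3P[].
rewrite inE negb_or adj_neq //=.
elim: s u ds {lw Us eau ep lp ap} => //= y s IH u /andP[/and3P[_ _ ya] ds].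
by rewrite inE negb_or eq_sym ya (IH y).
Qed.

Lemma subtree_cover a v : v != a -> exists2 u, e a u & v \in subtree e a u.
Proof.
move=> va; have [_ _ _ /(_ a v)/connectP[p0 ep0 lv] _] := e_tree.
case/shortenP: ep0 lv => [[|u p]] /=.
  by move=> _ _ _ /eqP; rewrite (negPf va).
move=> /andP[eau ep] /andP[ap _] _ ->; exists u => //.
exact: path_subtree.
Qed.

(** Both branches come from deleting the same unordered edge, so a common node would connect [u] to
    [a] without it. *)
Lemma subtree_opposite u a v : e u a ->
  v \in subtree e u a -> v \notin subtree e a u.
Proof.
move=> eua vua; apply/negP => vau.
have eau : e a u by rewrite e_sym.
have /negP := subtree_root eau; apply; move: vua vau.
rewrite !inE /delete_edge [X in connect [rel x y | e x y && (_ != X)]]setUC.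
move=> cav cuv; apply: connect_trans cuv _.
by rewrite (sym_connect_sym (@delete_edge_sym a u)).
Qed.

(** At [u], the node [a] roots a branch other than that of [w], so a path from [u] into the latter
    never meets [a]. *)
Lemma subtree_sub a u w : e a u -> e u w -> w != a ->
  subtree e u w \subset subtree e a u.
Proof.
move=> eau euw wa; apply/subsetP => x /(subtree_path euw)[p [ep lp Up sp]].
rewrite -lp -[last w p]/(last u (w :: p)); apply: path_subtree.
  by rewrite /= euw.
rewrite inE negb_or adj_neq //=; apply: contra wa => /sp awp.
apply/eqP; apply: (subtree_inj (x := a) euw) => //; first by rewrite e_sym.
exact: root_subtree.
Qed.

(** * Leaves in a tree with at least three nodes *)

Hypothesis T_gt2 : 2 < #|T|.

Lemma nonleaf_degree a : ~~ leaf e a -> 1 < #|neighbours e a|.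
Proof.
rewrite /leaf ltn_neqAle eq_sym => -> /=.
have /card_gt0P[v] : 0 < #|[set~ a]|.
  by rewrite cardsC1; case: #|T| T_gt2 => [|[]].
rewrite !inE => /subtree_cover[u eau _].
by apply/card_gt0P; exists u; rewrite inE.
Qed.

Lemma nonleaf_neighbour a b : ~~ leaf e a -> exists2 u, e a u & u != b.
Proof.
move/nonleaf_degree; rewrite (cardsD1 b) => N.
have /card_gt0P[u] : 0 < #|neighbours e a :\ b| by case: (b \in _) N => // /ltnW.
by rewrite !inE => /andP[ub eau]; exists u.
Qed.

Lemma leaf_neighbour l u w : leaf e l -> e l u -> e l w -> u = w.
Proof.
move/cards1P => [z /setP Nl] lu lw.
by move: (Nl u) (Nl w); rewrite !inE lu lw => /esym/eqP-> /esym/eqP->.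
Qed.

(** From two adjacent leaves no third node can be reached: a path leaving [u] through [w] could only
    step back to [u]. *)
Lemma adj_nonleaf u w : e u w -> ~~ leaf e u || ~~ leaf e w.
Proof.
move=> euw; rewrite -negb_and; apply/negP => /andP[lu lw].
have /card_gt0P[x] : 0 < #|~: [set u; w]|.
  have := cardsC [set u; w]; rewrite cards2 adj_neq // => E.
  by move: T_gt2; rewrite -E -[2]addn0 ltn_add2l.
rewrite !inE negb_or => /andP[xu xw].
have [y euy] := subtree_cover xu.
rewrite (leaf_neighbour lu euy euw) => /(subtreeP euw)[[|z p] [/= + lp _ +]].
  by rewrite -lp eqxx in xw.
case/andP=> ewz _ ; rewrite (leaf_neighbour lw ewz (w := u)) 1?e_sym //.
by rewrite !inE eqxx orbT.
Qed.

(** Unless [u] is a leaf, descend into a branch at [u] away from [a]; it is strictly smaller, since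
    it misses [u]. *)
Lemma subtree_leaf a u : e a u -> exists2 l, l \in subtree e a u & leaf e l.
Proof.
have [n] := ubnP #|subtree e a u|; elim: n => // n IH in a u *.
rewrite ltnS => len eau; have [lu|nlu] := boolP (leaf e u).
  by exists u => //; apply: root_subtree.
have [w euw wa] := nonleaf_neighbour a nlu.
have sub := subtree_sub eau euw wa.
have [|l ll leafl] := IH u w _ euw; last by exists l => //; apply: (subsetP sub).
apply: leq_trans len; apply: proper_card; apply/properP; split=> //.
by exists u; [apply: root_subtree | apply: subtree_root].
Qed.

Lemma tree_leaf : exists l, leaf e l.
Proof.
have /card_gt0P[a _] : 0 < #|T| by apply: leq_trans T_gt2.
have [//|nla] := boolP (leaf e a); first by exists a.
have [u eau _] := nonleaf_neighbour a nla.
by have [l _ ll] := subtree_leaf eau; exists l.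
Qed.

(** * Failure of 2-identifiability *)

Variable chi : placement T.

(** Under either routing a measurement path has at least two nodes, so each node on it has a
    neighbour on it. *)
Lemma measurement_leaf r l w p : leaf e l -> e l w ->
  measurement_path e chi r p -> l \in p -> w \in p.
Proof.
move=> ll elw; case: p => // x q /and4P[ep _ _ nt] lp.
have nq : q != [::] by case: r nt; case: q {ep lp} => //=; rewrite eqxx.
suff [z zp elz] : exists2 z, z \in x :: q & e l z.
  by rewrite (leaf_neighbour ll elw elz).
move: lp; rewrite inE => /predU1P[->|lq].
  case: q ep nq {nt} => // z q /= /andP[exz _] _.
  by exists z => //; rewrite !inE eqxx orbT.
case/splitPr: lq ep {nq nt} => q1 q2; rewrite cat_path /= => /and3P[_ ez _].
exists (last x q1); last by rewrite e_sym.
by rewrite -cat_cons mem_cat mem_last.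
Qed.

Lemma not_2_identifiable r : ~ identifiable e chi r 2.
Proof.
move=> id2; have [l ll] := tree_leaf.
have /cards1P[w /setP/(_ w)] := ll; rewrite !inE eqxx => elw.
apply: (id2 [set l; w] [set w]); rewrite ?cards2 ?cards1 //.
- apply/eqP => /setP/(_ l); rewrite !inE eqxx.
  by rewrite (negPf (adj_neq elw)).
- by case: (l != w).
move=> p; apply/existsP/existsP => -[x]; rewrite !inE.
  case/and3P=> /orP[] /eqP -> mp xp; exists w; rewrite !inE eqxx mp //=.
  exact: measurement_leaf mp xp.
by case/and3P=> /eqP -> mp xp; exists w; rewrite !inE eqxx orbT mp.
Qed.

(** * Probing sets and 1-identifiability *)

Definition separates r u v :=
  exists p, [/\ measurement_path e chi r p, u \in p & v \notin p].

Definition probing r (R : {pred T}) :=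
  [/\ {in R, forall a, ~~ leaf e a}, forall x y, e x y -> (x \in R) || (y \in R)
    & forall a u v, a \in R -> e a u -> v != a -> v \notin subtree e a u ->
      exists p, [/\ measurement_path e chi r p, a \in p, u \in p & v \notin p]].

Lemma probing_separates r R u v : probing r R -> u != v ->
  separates r u v \/ separates r v u.
Proof.
move=> [Rnl Redge Rpath].
have sepR x y : x \in R -> x != y -> separates r x y.
  move=> xR; rewrite eq_sym => yx; have [b exb yb] := subtree_cover yx.
  (* As [x] is not a leaf, it has a branch other than the one that contains [y]. *)
  have [w exw wb] := nonleaf_neighbour b (Rnl _ xR).
  have [|p [mp xp _ yp]] := Rpath x w y xR exw yx; last by exists p.
  by apply: contra wb => yw; apply/eqP; apply: subtree_inj yw yb.
move=> uv; have [uR|uR] := boolP (u \in R); first by left; apply: sepR.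
have [vR|vR] := boolP (v \in R); first by right; apply: sepR; rewrite 1?eq_sym.
(* With [u] outside [R], its neighbour [a] towards [v] lies in [R], hence differs from [v]. *)
have [|a eua va] := @subtree_cover u v; first by rewrite eq_sym.
have aR : a \in R by have := Redge _ _ eua; rewrite (negPf uR).
have [|||p [mp _ up vp]] := Rpath a u v aR; first by rewrite e_sym.
- by apply: contraNneq vR => ->.
- exact: subtree_opposite.
by left; exists p.
Qed.

(** This tells a singleton from the empty set. The node to avoid is an arbitrary one: the root of
    another branch. *)
Lemma probing_covers r R v : probing r R ->
  exists2 p, measurement_path e chi r p & v \in p.
Proof.
move=> [Rnl Redge Rpath].
have cov a u : a \in R -> e a u ->
    exists p, [/\ measurement_path e chi r p, a \in p & u \in p].
  move=> aR eau; have [w eaw wu] := nonleaf_neighbour u (Rnl _ aR).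
  have [||p [mp ap up _]] := Rpath a u w aR eau; last by exists p.
    by rewrite eq_sym adj_neq.
  by apply: contra wu => wS; apply/eqP; apply: subtree_inj (root_subtree a w) wS.
have /card_gt0P[x] : 0 < #|[set~ v]|.
  by rewrite cardsC1; case: #|T| T_gt2 => [|[]].
rewrite !inE => /subtree_cover[w evw _].
have /orP[vR|wR] := Redge _ _ evw.
  by have [p [mp vp _]] := cov v w vR evw; exists p.
by have [|p [mp _ vp]] := cov w v wR; [rewrite e_sym | exists p].
Qed.

Lemma paths_through_set1 r u p : (p \in paths_through_set e chi r [set u]) =
  measurement_path e chi r p && (u \in p).
Proof.
apply/existsP/idP => [[x]|up]; last by exists u; rewrite !inE eqxx.
by rewrite !inE => /andP[/eqP->].
Qed.

Lemma paths_through_set0 r p : (p \in paths_through_set e chi r set0) = false.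
Proof. by apply/existsP => -[x]; rewrite inE. Qed.

Lemma probing_identifiable r R : probing r R -> identifiable e chi r 1.
Proof.
move=> RP U W + cU cW.
have small (A : {set T}) : #|A| <= 1 -> A = set0 \/ exists x, A = [set x].
  case E: #|A| => [|[|]] // _; first by left; apply: cards0_eq.
  by right; apply/cards1P; rewrite E.
have [->|[u ->]] := small _ cU; have [->|[w ->]] := small _ cW.
- by rewrite eqxx.
- move=> _ PE; have [p mp wp] := probing_covers w RP.
  by have := PE p; rewrite paths_through_set0 paths_through_set1 mp wp.
- move=> _ PE; have [p mp up] := probing_covers u RP.
  by have := PE p; rewrite paths_through_set0 paths_through_set1 mp up.
move=> uw PE; have {}uw : u != w by apply: contra uw => /eqP->.
have [[p [mp pin /negPf pout]]|[p [mp pin /negPf pout]]] :=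
    probing_separates RP uw;
  by have := PE p; rewrite !paths_through_set1 mp pin pout.
Qed.

Lemma probing_maximal r R : probing r R ->
  maximal_identifiability e chi r 1.
Proof.
move=> RP; split=> [|j idj]; first exact: probing_identifiable RP.
rewrite leqNgt; apply/negP => j2; apply: (@not_2_identifiable r).
by move=> U W UW cU cW; apply: idj => //; apply: leq_trans j2.
Qed.

(** * Measurement paths in a monitor-balanced tree *)

Hypothesis chi_balanced : monitor_balanced e chi.

(** Of two distinct marked branches, at most one contains [v]. *)
Lemma marked_subtree_avoiding (M : {set T}) a v :
  2 <= #|[set S in subtrees e a | [exists x in S, x \in M]]| ->
  exists w x, [/\ e a w, v \notin subtree e a w, x \in subtree e a w & x \in M].
Proof.
case/card_gt1P=> S1 [S2 []].
rewrite !inE => /andP[/imsetP[w1 + ->] /exists_inP[x1 x1w x1M]].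
rewrite inE => ew1 /andP[/imsetP[w2 + ->] /exists_inP[x2 x2w x2M]].
rewrite inE => ew2 neq.
have [v1|v1] := boolP (v \in subtree e a w1); last by exists w1, x1.
exists w2, x2; split=> //; apply: contra neq => v2.
by rewrite (subtree_inj ew1 ew2 v1 v2).
Qed.

(** This form suits reversed and concatenated lists, whose first node is not syntactically visible;
    the default [a] is never returned. *)
Lemma measurement_pathE r a s : s != [::] -> measurement_path e chi r s =
  [&& sorted e s, head a s \in inputs chi, last a s \in outputs chi
    & match r with
      | CSP => uniq s && (head a s != last a s)
      | CAPminus => behead s != [::]
      end].
Proof. by case: s. Qed.

Lemma head_rev a s : head a (rev s) = last a s.
Proof. by case/lastP: s => [//|s x]; rewrite rev_rcons last_rcons. Qed.

Lemma sorted_rev s : sorted e (rev s) = sorted e s.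
Proof. by rewrite rev_sorted; apply: eq_sorted => x y; rewrite e_sym. Qed.

Lemma CAPminus_probing : probing CAPminus [pred a | ~~ leaf e a].
Proof.
split=> // [x y|a u v nla eau va vu]; first exact: adj_nonleaf.
have [I O] := chi_balanced nla.
have [w1 [x [e1 v1 xw xI]]] := marked_subtree_avoiding v I.
have [w2 [y [e2 v2 yw yO]]] := marked_subtree_avoiding v O.
have [p [ep lp _ sp]] := subtree_path e1 xw.
have [q [eq lq _ sq]] := subtree_path e2 yw.
(* The walk goes from [x] to [a], makes the detour to [u] and back, then goes to [y]. The branches
   of [w1], [w2] and [u] may coincide, as walks may repeat nodes. *)
exists (rev [:: a, w1 & p] ++ [:: u, a, w2 & q]).
rewrite !mem_cat !mem_rev !inE !eqxx !orbT; split=> //; last first.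
  rewrite !negb_or va /=.
  have -> : v != u by apply: contraNneq vu => ->; apply: root_subtree.
  have := contra (@sp v) v1; rewrite inE negb_or => ->.
  by have := contra (@sq v) v2; rewrite inE negb_or => ->.
rewrite (measurement_pathE _ a) /=; last by rewrite -size_eq0 size_cat size_rev.
rewrite rev_cons cat_rcons last_cat /= lq yO.
have -> : sorted e (rev (w1 :: p) ++ [:: a, u, a, w2 & q]).
  (* Moving the first [a] into the reversed half makes it the last node there, so that the edge at
     the junction is [e a u]. *)
  rewrite -(cat_rcons a) -rev_cons.
  case E: (rev _) => [|z s]; first by move/eqP: E; rewrite -size_eq0 size_rev.
  rewrite /= cat_path -[path e z s]/(sorted e (z :: s)) -E sorted_rev /= e1 ep.
  have -> : last z s = last a (z :: s) by [].
  by rewrite -E -head_rev revK /= eau [e u a]e_sym eau e2 eq.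
rewrite -[head _ _]nth0 nth_cat size_rev /= nth0 head_rev /= lp xI /=.
by rewrite -size_eq0 size_behead size_cat size_rev /= addnS.
Qed.

(** The path is simple with distinct ends because the two branches are disjoint and neither contains
    [a]. *)
Lemma simple_path_through a u w x y :
  e a u -> e a w -> u != w -> x \in subtree e a u -> y \in subtree e a w ->
  x \in inputs chi -> y \in outputs chi ->
  exists p, [/\ measurement_path e chi CSP p, a \in p, u \in p, w \in p &
    forall v, v != a -> v \notin subtree e a u -> v \notin subtree e a w ->
      v \notin p].
Proof.
move=> eau eaw uw xu yw xI yO.
have [p [ep lp Up sp]] := subtree_path eau xu.
have [q [eq lq Uq sq]] := subtree_path eaw yw.
exists (rev (u :: p) ++ [:: a, w & q]).
rewrite !mem_cat !mem_rev !inE !eqxx !orbT; split=> //; last first.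
  move=> v va vu vw; rewrite mem_cat mem_rev [v \in a :: _]in_cons.
  by apply/negP => /or3P[/sp||/sq]; apply/negP.
rewrite (measurement_pathE _ a) /=; last by rewrite -size_eq0 size_cat size_rev.
rewrite last_cat /= lq yO -[head _ _]nth0 nth_cat size_rev /= nth0 head_rev /=.
rewrite lp xI /=; apply/and3P; split.
- case E: (rev _) => [|z s]; first by move/eqP: E; rewrite -size_eq0 size_rev.
  rewrite /= cat_path -[path e z s]/(sorted e (z :: s)) -E sorted_rev /= ep.
  have -> : last z s = last a (z :: s) by [].
  by rewrite -E -head_rev revK /= e_sym eau eaw eq.
- have ap : a \notin u :: p := contra (@sp a) (subtree_root eau).
  have aq : a \notin w :: q := contra (@sq a) (subtree_root eaw).
  rewrite cat_uniq rev_uniq Up cons_uniq aq Uq !andbT andTb; apply/hasPn => z.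
  rewrite in_cons /= mem_rev => /predU1P[->//|/sq zw]; apply/negP => /sp zu.
  by rewrite (subtree_inj eau eaw zu zw) eqxx in uw.
by apply: contraNneq uw => xy; rewrite (subtree_inj eau eaw xu) // xy.
Qed.

(** Here [a] itself is one end. Since it may be of either kind, the branch must offer a monitor of
    both kinds for the other end. *)
Lemma simple_path_from a u i o :
  e a u -> a \in monitors chi -> i \in subtree e a u -> i \in inputs chi ->
  o \in subtree e a u -> o \in outputs chi ->
  exists p, [/\ measurement_path e chi CSP p, a \in p, u \in p &
    forall v, v != a -> v \notin subtree e a u -> v \notin p].
Proof.
move=> eau aM iu iI ou oO; have aNu := subtree_root eau.
have avoid p v : {subset u :: p <= subtree e a u} -> v != a ->
    v \notin subtree e a u -> v \notin [:: a, u & p].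
  by move=> sp va vu; rewrite inE negb_or va (contra (@sp v)).
case/setUP: aM => [aI|aO].
  have [p [ep lp Up sp]] := subtree_path eau ou.
  exists [:: a, u & p]; rewrite !inE !eqxx !orbT.
  split=> // [|v]; last exact: avoid.
  rewrite /measurement_path /= eau ep aI lp oO -/(uniq (u :: p)) Up /=.
  rewrite -[a \in _]/(a \in u :: p) (contra (@sp a)) //=.
  by apply: contraTneq ou => <-.
have [p [ep lp Up sp]] := subtree_path eau iu.
exists (rev [:: a, u & p]); rewrite !mem_rev !inE !eqxx !orbT.
split=> // [|v]; last by rewrite mem_rev; apply: avoid.
rewrite (measurement_pathE _ a) -?size_eq0 ?size_rev // sorted_rev rev_uniq.
rewrite -[last a (rev _)]head_rev revK head_rev /= eau ep lp iI aO -/(uniq (u :: p)) Up.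
rewrite -[a \in _]/(a \in u :: p) (contra (@sp a)) //=.
by apply: contraTneq iu => ->.
Qed.

Hypothesis nondegenerate : CSP_nondegenerate e chi.

Lemma CSP_probing : probing CSP
  [pred a | ~~ leaf e a && ((2 < #|neighbours e a|) || (a \in monitors chi))].
Proof.
have [leaf_mon edge_mon] := nondegenerate.
have monP a u : e a u -> exists2 x, x \in subtree e a u & x \in monitors chi.
  by case/subtree_leaf => l lu /leaf_mon; exists l.
have nl3 a : 2 < #|neighbours e a| -> ~~ leaf e a.
  by rewrite /leaf; apply: contraTneq => ->.
split=> [a /andP[] //|x y exy|a u v].
  rewrite !inE; have [x3|x3] := ltnP 2 #|neighbours e x|; first by rewrite nl3.
  have [y3|y3] := ltnP 2 #|neighbours e y|; first by rewrite (nl3 y) ?orbT.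
  by have := edge_mon x y exy x3 y3; rewrite !inE.
case/andP=> nla rich eau va vu; have [I O] := chi_balanced nla.
(* Either direction of travel will do, so only the kinds of the two end monitors have to be
   opposite. *)
have thru w x y : e a w -> w != u -> v \notin subtree e a w ->
    x \in subtree e a u -> y \in subtree e a w ->
    x \in inputs chi /\ y \in outputs chi \/
    x \in outputs chi /\ y \in inputs chi ->
    exists p, [/\ measurement_path e chi CSP p, a \in p, u \in p & v \notin p].
  move=> eaw wu vw xu yw [] [xM yM].
    have [|p [mp ap up _ avoid]] := simple_path_through eau eaw _ xu yw xM yM.
      by rewrite eq_sym.
    by exists p; split=> //; apply: avoid.
  have [p [mp ap _ up avoid]] := simple_path_through eaw eau wu yw xu yM xM.
  by exists p; split=> //; apply: avoid.
have [/exists_inP[i iu iI]|noI] := boolP (input_tree chi (subtree e a u));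
  have [/exists_inP[o ou oO]|noO] := boolP (output_tree chi (subtree e a u)).
- case/orP: rich => [deg3|aM]; last first.
    have [p [mp ap up avoid]] := simple_path_from eau aM iu iI ou oO.
    by exists p; split=> //; apply: avoid.
  (* Degree at least 3 leaves a branch that is neither that of [u] nor that of [v]. Its monitor, of
     whichever kind, pairs with one of the opposite kind in the branch of [u]. *)
  have [b eab vb] := subtree_cover va.
  have /card_gt0P[w] : 0 < #|neighbours e a :\ u :\ b|.
    move: deg3; rewrite (cardsD1 u) (cardsD1 b (_ :\ u)).
    by case: (u \in _); case: (b \in _); case: #|_|.
  rewrite !inE => /and3P[wb wu eaw].
  have vw : v \notin subtree e a w.
    by apply: contra wb => vw; apply/eqP; apply: subtree_inj vw vb.
  have [y yw /setUP[yM|yM]] := monP _ _ eaw.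
    by apply: (thru w o y) => //; right.
  by apply: (thru w i y) => //; left.
(* Balance gives an output branch avoiding [v]; it is not that of [u], which has no output. *)
- have [w [y [eaw vw yw yO]]] := marked_subtree_avoiding v O.
  apply: (thru w i y) => //; last by left.
  by apply: contraNneq noO => <-; apply/exists_inP; exists y.
- have [w [y [eaw vw yw yI]]] := marked_subtree_avoiding v I.
  apply: (thru w o y) => //; last by right.
  by apply: contraNneq noI => <-; apply/exists_inP; exists y.
(* The branch of [u] contains a leaf, hence a monitor, so it cannot lack both kinds. *)
have [x xu /setUP[] xM] := monP _ _ eau.
  by case/negP: noI; apply/exists_inP; exists x.
by case/negP: noO; apply/exists_inP; exists x.
Qed.

End Tree.

Theorem theorem5 (T : finType) (e : rel T) (chi : placement T)
    (e_tree : is_tree e) (T_gt2 : 2 < #|T|)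
    (chi_balanced : monitor_balanced e chi) :
  maximal_identifiability e chi CAPminus 1 /\
  (CSP_nondegenerate e chi -> maximal_identifiability e chi CSP 1).
Proof.
split=> [|nondeg]; apply: probing_maximal => //.
  exact: CAPminus_probing.
exact: CSP_probing.
Qed.
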